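(* Let $q\in\mathbb{N}$ and let $(\vec{H},h)$ be a $q$-coloured in-orientation of a graph $H$. Let $\vec{G}$ be an orientation of a graph $G$ and let $\psi$ be an out-neighbourhood bijective homomorphism from $\vec{G}$ to $\vec{H}$. Then $(\vec{G},h\circ\psi)$ is a $q$-coloured in-orientation of $G$.
   Context: Graphs are finite and simple. A $q$-colouring of $G$ is a map $V(G)\to\mathbb{Z}_q$ assigning distinct colours to adjacent vertices. For an orientation $\vec{G}$ of $G$ and a $q$-colouring $f$ of $G$, $(\vec{G},f)$ is a $q$-coloured in-orientation if for every vertex $v$: (i) no out-neighbour of $v$ has the same colour as an in-neighbour of $v$, and (ii) the out-neighbours of $v$ have pairwise distinct colours. An out-neighbourhood bijective homomorphism from $\vec{G}$ to $\vec{H}$ is a map $\psi\colon V(\vec{G})\to V(\vec{H})$ such that for every vertex $v$ the restriction of $\psi$ to $N^+_{\vec{G}}(v)$ is a bijection onto $N^+_{\vec{H}}(\psi(v))$. *)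

(* Defs.v *)
From mathcomp Require Import all_boot.

Set Implicit Arguments.
Unset Strict Implicit.
Unset Printing Implicit Defensive.

Record sgraph := SGraph {
  vertex :> finType;
  adj : rel vertex;
  adj_sym : symmetric adj;
  adj_irrefl : irreflexive adj }.

(* Every edge gets exactly one of its two directions, and there is no arc
   between non-adjacent vertices. *)
Record orientation (G : sgraph) := Orientation {
  arc :> rel G;
  arc_adj : forall u v : G, adj u v = arc u v || arc v u;
  arc_antisym : forall u v : G, ~~ (arc u v && arc v u) }.

Definition out_nbrs (G : sgraph) (D : orientation G) (v : G) : {set G} :=
  [set w | D v w].

Definition in_nbrs (G : sgraph) (D : orientation G) (v : G) : {set G} :=
  [set u | D u v].

(* The colour set Z_q is represented by 'I_q = {0, ..., q - 1}: only equality of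
   colours matters, and MathComp's 'Z_q has two elements when q < 2. *)
Definition colouring (q : nat) (G : sgraph) (f : G -> 'I_q) : Prop :=
  forall u v : G, adj u v -> f u <> f v.

Definition coloured_in_orientation (q : nat) (G : sgraph)
    (D : orientation G) (f : G -> 'I_q) : Prop :=
  colouring f /\
  forall v : G,
    (forall u w : G, w \in out_nbrs D v -> u \in in_nbrs D v -> f w <> f u) /\
    {in out_nbrs D v &, injective f}.

Definition out_nbr_bijective_hom (G H : sgraph)
    (DG : orientation G) (DH : orientation H) (psi : G -> H) : Prop :=
  forall v : G,
    {in out_nbrs DG v &, injective psi} /\
    psi @: out_nbrs DG v = out_nbrs DH (psi v).

(* Main.v *)
Require Import Defs.
From mathcomp Require Import all_boot.

(** As [psi] maps out-neighbours of [v] to out-neighbours of [psi v], it sends arcs to arcs.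
    Properness and condition (i) therefore pull back along [psi]. Condition (ii) composes two
    injections: [psi] on the out-neighbours of [v], then [h] on those of [psi v]. *)

Lemma out_nbr_bijective_hom_arc (G H : sgraph) (DG : orientation G)
    (DH : orientation H) (psi : G -> H) :
  out_nbr_bijective_hom DG DH psi ->
  forall u v : G, DG u v -> DH (psi u) (psi v).
Proof.
move=> hpsi u v uv; have [_ im_psi] := hpsi u.
suff: psi v \in out_nbrs DH (psi u) by rewrite inE.
by rewrite -im_psi imset_f // inE.
Qed.

Theorem theorem3 (q : nat) (H : sgraph) (DH : orientation H) (h : H -> 'I_q)
    (hH : coloured_in_orientation DH h)
    (G : sgraph) (DG : orientation G) (psi : G -> H)
    (hpsi : out_nbr_bijective_hom DG DH psi) :
  coloured_in_orientation DG (h \o psi).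
Proof.
have arc_psi := @out_nbr_bijective_hom_arc _ _ _ _ _ hpsi.
have [col_h in_h] := hH; split=> [u v | v].
  (* Edges are handled through their two possible arcs, whose direction [psi] preserves. *)
  rewrite (arc_adj DG) => uv; apply: col_h; rewrite (arc_adj DH).
  by case/orP: uv => /arc_psi ->; rewrite ?orbT.
have [sep_h inj_h] := in_h (psi v); have [inj_psi _] := hpsi v; split.
  move=> u w; rewrite !inE => /arc_psi vw /arc_psi uv.
  by apply: sep_h; rewrite inE.
(* Equal colours force [psi x = psi y], both being out-neighbours of [psi v]. *)
move=> x y vx vy /= hxy; apply: inj_psi => //; apply: inj_h => //.
  by move: vx; rewrite !inE => /arc_psi.
by move: vy; rewrite !inE => /arc_psi.
Qed.
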